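(* For any $\beta>0$, the mixing time of the parallel column dynamics $\mathcal M^{\mathrm{par}}_n$ is $O(n^2\log n)$.
   Context: Fix $\beta>0$ and integer $n\ge1$. Configurations are $\eta\in\Omega_n=\{0,\dots,n\}^n$ with $\eta(0)=\eta(n+1)=0$, and $\mu(\eta)\propto\exp\{-\beta\sum_{i=1}^{n+1}|\eta(i-1)-\eta(i)|\}$. A column update at position $i$ replaces $\eta(i)$ by $j\in\{0,\dots,n\}$ chosen with probability proportional to $\mu(\eta^j)$, $\eta^j$ being $\eta$ with $\eta(i)$ replaced by $j$. Let $O$ denote the operation of performing (independent) column updates simultaneously at all odd positions in $\{1,\dots,n\}$, and $E$ the same at all even positions. The parallel column dynamics $\mathcal M^{\mathrm{par}}_n$ run for $t$ steps is defined as: flip a fair coin; if heads apply the update sequence $(OE)^t$ ($t$ alternating odd-then-even pairs), if tails apply $(EO)^t$. Its mixing time is the least $t$ such that, from every initial configuration, the resulting law is within total variation distance $1/(2e)$ of $\mu$. *)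

(* Defs.v *)
From mathcomp Require Import all_boot all_order all_algebra.
From mathcomp Require Import all_classical all_reals all_analysis.

Set Implicit Arguments. Unset Strict Implicit. Unset Printing Implicit Defensive.
Import Order.TTheory GRing.Theory Num.Theory.
Local Open Scope ring_scope.

(* Configurations: eta : 'I_n -> {0,...,n}; the index i : 'I_n stands for the
   column at position i+1 (positions 1..n).  Boundary heights are 0. *)
Definition config (n : nat) := {ffun 'I_n -> 'I_n.+1}.

Definition hgt (n : nat) (eta : config n) (k : nat) : nat :=
  match k with
  | 0 => 0
  | k'.+1 => match (insub k' : option 'I_n) with
             | Some i => nat_of_ord (eta i)
             | None => 0
             end
  end.

Definition energy (n : nat) (eta : config n) : nat :=
  (\sum_(k < n.+1) absz ((hgt eta k)%:Z - (hgt eta k.+1)%:Z))%N.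

Definition weight (R : realType) (beta : R) (n : nat) (eta : config n) : R :=
  expR (- beta * (energy eta)%:R).

Definition gibbs (R : realType) (beta : R) (n : nat) (eta : config n) : R :=
  weight beta eta / \sum_(z : config n) weight beta z.

Definition setcol (n : nat) (eta : config n) (i : 'I_n) (j : 'I_n.+1) : config n :=
  [ffun k => if k == i then j else eta k].

Definition col_prob (R : realType) (beta : R) (n : nat) (eta : config n)
  (i : 'I_n) (j : 'I_n.+1) : R :=
  weight beta (setcol eta i j) / \sum_(j' : 'I_n.+1) weight beta (setcol eta i j').

(* transition kernel of independent simultaneous column updates at all
   positions in S (each update uses the current configuration eta) *)
Definition par_kernel (R : realType) (beta : R) (n : nat) (S : pred 'I_n)
  (eta eta' : config n) : R :=
  if [forall k, (~~ S k) ==> (eta' k == eta k)]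
  then \prod_(i | S i) col_prob beta eta i (eta' i)
  else 0.

(* odd / even positions (position of index i is i+1) *)
Definition oddpos (n : nat) : pred 'I_n := fun i => odd i.+1.
Definition evenpos (n : nat) : pred 'I_n := fun i => ~~ odd i.+1.

Definition step_law (R : realType) (n : nat) (K : config n -> config n -> R)
  (nu : config n -> R) : config n -> R :=
  fun y => \sum_(x : config n) nu x * K x y.

Definition dirac (R : realType) (n : nat) (x : config n) : config n -> R :=
  fun y => (y == x)%:R.

Definition law_OE (R : realType) (beta : R) (n : nat) (t : nat) (x : config n)
  : config n -> R :=
  iter t (fun nu => step_law (par_kernel beta (@evenpos n))
                     (step_law (par_kernel beta (@oddpos n)) nu)) (dirac R x).

Definition law_EO (R : realType) (beta : R) (n : nat) (t : nat) (x : config n)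
  : config n -> R :=
  iter t (fun nu => step_law (par_kernel beta (@oddpos n))
                     (step_law (par_kernel beta (@evenpos n)) nu)) (dirac R x).

Definition par_law (R : realType) (beta : R) (n : nat) (t : nat) (x : config n)
  : config n -> R :=
  fun y => 2^-1 * law_OE beta t x y + 2^-1 * law_EO beta t x y.

Definition tv_dist (R : realType) (n : nat) (nu mu : config n -> R) : R :=
  2^-1 * \sum_(y : config n) `|nu y - mu y|.

Definition mixed_by (R : realType) (beta : R) (n : nat) (t : nat) : Prop :=
  forall x : config n, tv_dist (par_law beta t x) (gibbs beta (n:=n)) <= (2 * expR 1)^-1.

(* Main.v *)
Require Import Defs.
From mathcomp Require Import all_boot all_order all_algebra.
From mathcomp Require Import all_classical all_reals all_analysis.
From mathcomp Require Import ring lra zify.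
Import Order.TTheory GRing.Theory Num.Theory.
Local Open Scope ring_scope.

(* The argument is the dual form of path coupling.  Record, for a test function f on
   configurations, how much it varies when the single column i is moved by one unit.
   The mean height drawn in a column, given heights a and b on its two sides, grows by
   at most 1/2 when a grows by 1 (without floor and ceiling it would be exactly (a+b)/2;
   truncation only helps).  Hence updating column i sends the variation at i to 0 and
   passes at most half of it to each neighbour, and a simultaneous update at all columns
   of one parity averages the variations over neighbours.  The profile i(n+1-i) is
   strictly superharmonic for this averaging, so the variations contract by 1 - 1/n^2
   per step; starting from a function bounded by 1 they are summably small after
   O(n^2 log n) steps, and invariance of the Gibbs measure turns this into a total
   variation bound. *)

(** * Displacement of the mean of a single column *)

Lemma one_sub_exp_le {R : realFieldType} (q : R) (m : nat) :
  0 <= q <= 1 -> 1 - q ^+ m <= m%:R * (1 - q).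
Proof.
move=> /andP[q0 q1]; elim: m => [|m IH]; first by rewrite expr0 subrr mul0r.
rewrite exprS -natr1.
have : 0 <= q ^+ m by exact: exprn_ge0.
have : q ^+ m <= 1 by exact: exprn_ile1.
nra.
Qed.

Lemma upper_sum_closed {R : realFieldType} (q : R) (N : nat) :
  let V := \sum_(i < N) q ^+ i.+1 in
  (1 - q) * V = q * (1 - q ^+ N) /\
  (1 - q) * \sum_(i < N) (2 * i%:R + 1) * q ^+ i.+1 =
    q * (1 + 2 * V - (2 * N%:R + 1) * q ^+ N).
Proof.
elim: N => [|N [IH1 IH2]] /=; first by rewrite !big_ord0 expr0; split; ring.
rewrite !big_ord_recr /= !mulrDr IH1 IH2 -natr1 !exprS; split; ring.
Qed.

(** Truncated subtraction makes the first [d.+1] weights equal to 1, after which they decay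
    geometrically. Subtracting [U ^+ 2] removes [d] from the second identity. *)
Lemma lower_sum_closed {R : realFieldType} (q : R) (d b : nat) :
  let U := \sum_(i < (d + b).+1) q ^+ (i - d) in
  (1 - q) * U = (1 - q) * d.+1%:R + q * (1 - q ^+ b) /\
  (1 - q) ^+ 2 * (\sum_(i < (d + b).+1) (2 * i%:R + 1) * q ^+ (i - d) - U ^+ 2) =
    q * ((1 - q ^+ b) * (1 + q * q ^+ b) - 2 * b%:R * q ^+ b * (1 - q)).
Proof.
elim: b => [|b [IH1 IH2]] /=.
  rewrite addn0.
  have e (F : nat -> R) :
      \sum_(i < d.+1) F i * q ^+ (i - d) = \sum_(i < d.+1) F i.
    apply: eq_bigr => i _; rewrite (_ : (i - d = 0)%N) ?expr0 ?mulr1 //.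
    by apply/eqP; rewrite subn_eq0 -ltnS.
  have -> : \sum_(i < d.+1) q ^+ (i - d) = d.+1%:R.
    rewrite (eq_bigr (fun i : 'I_d.+1 => 1 * q ^+ (i - d))); last first.
      by move=> i _; rewrite mul1r.
    by rewrite (e (fun=> 1)) sumr_const card_ord.
  rewrite (e (fun i => 2 * i%:R + 1)).
  have -> : \sum_(i < d.+1) (2 * i%:R + 1) = d.+1%:R ^+ 2 :> R.
    elim: d.+1 => [|m IH]; first by rewrite big_ord0 expr0n.
    by rewrite big_ord_recr /= IH -natr1; ring.
  by rewrite expr0; split; ring.
rewrite addnS !(big_ord_recr (d + b).+1) /= (_ : ((d + b).+1 - d = b.+1)%N); last by lia.
set U := (\sum_(i < _) q ^+ (i - d)) in IH1 IH2 *.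
set W := (\sum_(i < _) _) in IH2 *.
have -> : ((d + b).+1)%:R = d.+1%:R + b%:R :> R by rewrite -natrD.
rewrite mulrDr IH1; split; first by rewrite (exprS q b); ring.
have -> : (1 - q) ^+ 2 * (W + (2 * (d.+1%:R + b%:R) + 1) * q ^+ b.+1 - (U + q ^+ b.+1) ^+ 2)
  = (1 - q) ^+ 2 * (W - U ^+ 2)
    + (1 - q) ^+ 2 * ((2 * (d.+1%:R + b%:R) + 1) * q ^+ b.+1 - q ^+ b.+1 ^+ 2)
    - 2 * (1 - q) * q ^+ b.+1 * ((1 - q) * U) by ring.
by rewrite IH2 IH1 (exprS q b) -[b.+1%:R]natr1; ring.
Qed.

(** The bound 1/2 on the displacement of a mean comes down to this. [U] and [V] are the masses below
    and above the gap that the neighbour crosses; [2 * i%:R + 1] adds the distances to the two ends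
    of the gap. *)
Lemma site_inequality {R : realFieldType} (q : R) (d b N : nat) :
  0 < q < 1 ->
  let U := \sum_(i < (d + b).+1) q ^+ (i - d) in
  let V := \sum_(i < N) q ^+ i.+1 in
  (1 - q) * ((\sum_(i < N) (2 * i%:R + 1) * q ^+ i.+1) * U
    + (\sum_(i < (d + b).+1) (2 * i%:R + 1) * q ^+ (i - d)) * V)
  <= (q * U + V) * (U + V).
Proof.
move=> /andP[q0 q1] /=; set U := \sum_(i < (d + b).+1) q ^+ _; set V := \sum_(i < N) q ^+ _.
have [] := @upper_sum_closed R q N; have [] := @lower_sum_closed R q d b.
rewrite -/U -/V; set SU := \sum_(i < _) _; set SV := \sum_(i < _) _.
have q01 : 0 <= q <= 1 by rewrite !ltW.
have := @one_sub_exp_le R q N q01; have := @one_sub_exp_le R q b.+1 q01.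
have : 0 < q ^+ N by exact: exprn_gt0.
have : 0 < q ^+ b by exact: exprn_gt0.
have : q ^+ N <= 1 by apply: exprn_ile1 => //; exact: ltW.
have : q ^+ b <= 1 by apply: exprn_ile1 => //; exact: ltW.
rewrite (exprS q b) -[b.+1%:R]natr1; set e := q ^+ b; set x := q ^+ N.
have : 1 <= d.+1%:R :> R by rewrite ler1n.
set D := d.+1%:R.
have : 0 <= b%:R :> R by []. have : 0 <= N%:R :> R by [].
set B := b%:R; set M := N%:R => M0 B0 D1 e1 x1 e0 x0 hB hM hU hSU hV hSV.
have p0 : 0 < 1 - q by lra.
(* the inequality without its d-dependence, scaled by (1 - q)^2 *)
have key : q * ((1 - e) * (1 + q * e) - 2 * B * e * (1 - q)) * (1 - x) <=
   x * (1 - q * e) ^+ 2 + 2 * M * x * (1 - q * e) * (1 - q) + (1 - x) ^+ 2 * q.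
  have y0 : 0 < q * e by nra.
  have y1 : q * e <= 1 by nra.
  (* The two sides of [key] differ by exactly twice the quantity of [h1] plus those of [h2] to [h7];
     the Bernoulli bounds enter through [h1] and [h2]. *)
  have h1 : 0 <= x * (1 - q * e) * (M * (1 - q) - (1 - x)).
    by apply: mulr_ge0; [apply: mulr_ge0; lra | lra].
  have h2 : 0 <= (1 - x) * (q * e) * ((B + 1) * (1 - q) - (1 - q * e)).
    by apply: mulr_ge0; [apply: mulr_ge0; lra | lra].
  have h3 : 0 <= (1 - x) * (q * e) * (B * (1 - q)).
    by apply: mulr_ge0; apply: mulr_ge0; lra.
  have h4 : 0 <= (1 - x) * (x * (1 - q)) by apply: mulr_ge0; [lra|apply: mulr_ge0; lra].
  have h5 : 0 <= x * (1 - q * e) ^+ 2 by apply: mulr_ge0; [lra|exact: sqr_ge0].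
  have h6 : 0 <= x * (1 - q * e) * (1 - x) by apply: mulr_ge0; [apply: mulr_ge0; lra|lra].
  have h7 : 0 <= (1 - x) * (q * e) * (1 - x).
    by apply: mulr_ge0; [apply: mulr_ge0; lra|lra].
  lra.
(* Equality holds at [d = 0]. A larger [d] only increases [U], and with it the right side of
   [key2]. *)
have U1 : (1 - q * e) <= (1 - q) * U by rewrite hU; nra.
have U0 : 0 <= 1 - q * e by nra.
have key2 : (1 - q) ^+ 2 * (SU - U ^+ 2) * (1 - x) <=
   (1 - q) ^+ 2 * (x * U ^+ 2 + 2 * M * x * U + V ^+ 2 + (1 - x) * V).
  have -> : (1 - q) ^+ 2 * (x * U ^+ 2 + 2 * M * x * U + V ^+ 2 + (1 - x) * V) =
     x * ((1 - q) * U) ^+ 2 + 2 * M * x * ((1 - q) * U) * (1 - q) + ((1 - q) * V) ^+ 2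
     + (1 - q) * (1 - x) * ((1 - q) * V) by ring.
  rewrite hSU hV; apply: (le_trans key).
  have s1 : x * (1 - q * e) ^+ 2 <= x * ((1 - q) * U) ^+ 2.
    by rewrite ler_pM2l // ler_sqr ?nnegrE //; lra.
  have s2 : 2 * M * x * (1 - q * e) * (1 - q) <= 2 * M * x * ((1 - q) * U) * (1 - q).
    rewrite ler_wpM2r ?(ltW p0) // ler_wpM2l //.
    by apply: mulr_ge0; [lra|exact: ltW].
  nra.
have key3 : (SU - U ^+ 2) * (1 - x) <= x * U ^+ 2 + 2 * M * x * U + V ^+ 2 + (1 - x) * V.
  by rewrite -(@ler_pM2l _ ((1 - q) ^+ 2)) ?exprn_gt0 // mulrA.
have -> : (1 - q) * (SV * U + SU * V) = ((1 - q) * SV) * U + SU * ((1 - q) * V) by ring.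
have -> : (q * U + V) * (U + V) = q * U ^+ 2 + 2 * q * U * V + ((1 - q) * V) * U
    + q * V ^+ 2 + ((1 - q) * V) * V by ring.
rewrite hSV hV.
have := ler_wpM2l (ltW q0) key3.
nra.
Qed.

(** * The law of one column between two neighbours *)

Definition hdist (a b : nat) : nat := absz (a%:Z - b%:Z).

(** With [s = expR (- beta)], the part of the Gibbs weight due to the two edges at a column of
    height [k]. *)
Definition site_weight {R : realFieldType} (s : R) (a b k : nat) : R :=
  s ^+ (hdist a k + hdist k b).

Definition site_mean {R : realFieldType} (s : R) (n a b : nat) (phi : nat -> R) : R :=
  (\sum_(k < n.+1) site_weight s a b k * phi k) / \sum_(k < n.+1) site_weight s a b k.

Definition lipschitz_upto {R : realFieldType} (n : nat) (phi : nat -> R) (L : R) : Prop :=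
  forall k l : nat, (k <= n)%N -> (l <= n)%N -> `|phi k - phi l| <= L * (hdist k l)%:R.

Lemma site_weight_sum_gt0 {R : realFieldType} (s : R) (n a b : nat) :
  0 < s -> 0 < \sum_(k < n.+1) site_weight s a b k.
Proof.
move=> s0; rewrite big_ord_recl; apply: ltr_pwDl; first exact: exprn_gt0.
by apply: sumr_ge0 => i _; exact/ltW/exprn_gt0.
Qed.

(** Both sums run outwards from the gap between [a] and [a.+1], so the lower one is reversed. *)
Lemma sum_split_at {R : realFieldType} (a N : nat) (F : nat -> R) :
  \sum_(k < (a + N).+1) F k =
  \sum_(i < a.+1) F (a - i)%N + \sum_(i < N) F (a.+1 + i)%N.
Proof.
rewrite -addSn big_split_ord /=; congr (_ + _).
rewrite (reindex_inj rev_ord_inj) /=; apply: eq_bigr => i _.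
by rewrite subSS.
Qed.

(** Raising the neighbour multiplies the weights up to [a] by [q = s ^+ 2] relative to those above.
    The difference of the means becomes a quotient of half-sums, which the Lipschitz bound reduces
    to [site_inequality]. *)
Lemma site_mean_succ_below {R : realFieldType} (s : R) (n a b : nat) (phi : nat -> R) (L : R) :
  0 < s < 1 -> (b <= a)%N -> (a < n)%N -> lipschitz_upto n phi L ->
  `|site_mean s n a.+1 b phi - site_mean s n a b phi| <= L / 2.
Proof.
move=> /andP[s0 s1] ba an lip.
have [N nE] : exists N, n = (a + N)%N by exists (n - a)%N; rewrite subnKC // ltnW.
have L0 : 0 <= L.
  have := lip 0%N 1%N; rewrite (_ : hdist 0 1 = 1%N) // mulr1 => /(_ isT) h.
  by apply: le_trans (h _); [exact: normr_ge0|lia].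
set q := s ^+ 2.
have q0 : 0 < q by exact: exprn_gt0.
have q1 : q < 1 by rewrite exprn_ilt1 // ltW.
set d := (a - b)%N.
have aE : a = (d + b)%N by rewrite /d subnK.
(* Between [b] and [a] the total distance to both neighbours is constantly [d]; outside, every unit
   costs two. *)
have wl i : (i < a.+1)%N -> site_weight s a b (a - i)%N = s ^+ d * q ^+ (i - d).
  move=> ia; rewrite /site_weight /q -exprM -exprD; congr (_ ^+ _).
  by rewrite /hdist /d; lia.
have wr i : site_weight s a b (a.+1 + i)%N = s ^+ d * q ^+ i.+1.
  rewrite /site_weight /q -exprM -exprD; congr (_ ^+ _).
  by rewrite /hdist /d; lia.
(* Each lower height is now one unit further from the neighbour, each upper one a unit closer. With
   [s ^+ d / s] taken out, only the lower half acquires a factor [q]. *)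
have wl' i : (i < a.+1)%N -> site_weight s a.+1 b (a - i)%N = s ^+ d / s * (q * q ^+ (i - d)).
  move=> ia; have -> : s ^+ d / s * (q * q ^+ (i - d)) = s ^+ d * s * q ^+ (i - d).
    by rewrite /q; field; rewrite gt_eqF.
  rewrite -exprSr /site_weight /q -exprM -exprD; congr (_ ^+ _).
  by rewrite /hdist /d; lia.
have wr' i : site_weight s a.+1 b (a.+1 + i)%N = s ^+ d / s * q ^+ i.+1.
  have -> : s ^+ d / s * q ^+ i.+1 = s ^+ d * s * q ^+ i.
    by rewrite exprS /q; field; rewrite gt_eqF.
  rewrite -exprSr /site_weight /q -exprM -exprD; congr (_ ^+ _).
  by rewrite /hdist /d; lia.
set U := \sum_(i < a.+1) q ^+ (i - d).
set V := \sum_(i < N) q ^+ i.+1.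
have Upos : 0 < U.
  rewrite /U big_ord_recl; apply: ltr_pwDl; first exact: exprn_gt0.
  by apply: sumr_ge0 => i _; exact/ltW/exprn_gt0.
have Vpos : 0 <= V by apply: sumr_ge0 => i _; exact/ltW/exprn_gt0.
set A := \sum_(i < a.+1) q ^+ (i - d) * phi (a - i)%N.
set B := \sum_(i < N) q ^+ i.+1 * phi (a.+1 + i)%N.
have c0 : s ^+ d != 0 by rewrite expf_neq0 // gt_eqF.
have s0' : s != 0 by rewrite gt_eqF.
have m0 : site_mean s n a b phi = (A + B) / (U + V).
  rewrite /site_mean nE.
  rewrite (sum_split_at a N (fun k => site_weight s a b k * phi k)).
  rewrite (sum_split_at a N (site_weight s a b)).
  have -> : \sum_(i < a.+1) site_weight s a b (a - i)%N * phi (a - i)%N = s ^+ d * A.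
    by rewrite mulr_sumr; apply: eq_bigr => i _; rewrite wl ?mulrA.
  have -> : \sum_(i < a.+1) site_weight s a b (a - i)%N = s ^+ d * U.
    by rewrite mulr_sumr; apply: eq_bigr => i _; rewrite wl.
  have -> : \sum_(i < N) site_weight s a b (a.+1 + i)%N * phi (a.+1 + i)%N = s ^+ d * B.
    by rewrite mulr_sumr; apply: eq_bigr => i _; rewrite wr ?mulrA.
  have -> : \sum_(i < N) site_weight s a b (a.+1 + i)%N = s ^+ d * V.
    by rewrite mulr_sumr; apply: eq_bigr => i _; rewrite wr.
  by rewrite -!mulrDr -mulf_div divff // mul1r.
have m1 : site_mean s n a.+1 b phi = (q * A + B) / (q * U + V).
  rewrite /site_mean nE.
  rewrite (sum_split_at a N (fun k => site_weight s a.+1 b k * phi k)).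
  rewrite (sum_split_at a N (site_weight s a.+1 b)).
  have -> : \sum_(i < a.+1) site_weight s a.+1 b (a - i)%N * phi (a - i)%N
      = s ^+ d / s * (q * A).
    by rewrite !mulr_sumr; apply: eq_bigr => i _; rewrite wl' // !mulrA.
  have -> : \sum_(i < a.+1) site_weight s a.+1 b (a - i)%N = s ^+ d / s * (q * U).
    by rewrite !mulr_sumr; apply: eq_bigr => i _; rewrite wl'.
  have -> : \sum_(i < N) site_weight s a.+1 b (a.+1 + i)%N * phi (a.+1 + i)%N
      = s ^+ d / s * B.
    by rewrite mulr_sumr; apply: eq_bigr => i _; rewrite wr' ?mulrA.
  have -> : \sum_(i < N) site_weight s a.+1 b (a.+1 + i)%N = s ^+ d / s * V.
    by rewrite mulr_sumr; apply: eq_bigr => i _; rewrite wr'.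
  by rewrite -!mulrDr -mulf_div divff ?mul1r // mulf_neq0 // invr_neq0.
set c := (phi a + phi a.+1) / 2.
set SU := \sum_(i < a.+1) (2 * i%:R + 1) * q ^+ (i - d).
set SV := \sum_(i < N) (2 * i%:R + 1) * q ^+ i.+1.
(* recentring phi between a and a+1 makes the two half-sums comparable to SU, SV *)
have hA : `|A - c * U| <= L / 2 * SU.
  rewrite /A /U /SU !mulr_sumr -sumrB; apply: le_trans (ler_norm_sum _ _ _) _.
  apply: ler_sum => i _.
  have -> : q ^+ (i - d) * phi (a - i)%N - c * q ^+ (i - d) =
     q ^+ (i - d) * (((phi (a - i)%N - phi a) + (phi (a - i)%N - phi a.+1)) / 2).
    by rewrite /c; field.
  rewrite normrM (ger0_norm (ltW (exprn_gt0 _ q0))).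
  rewrite [leRHS](_ : _ = q ^+ (i - d) * (L / 2 * (2 * i%:R + 1))); last by ring.
  rewrite (ler_wpM2l (ltW (exprn_gt0 _ q0))) // normrM [`|2^-1|]ger0_norm ?invr_ge0 //.
  have ia := ltn_ord i.
  have := lip (a - i)%N a; have := lip (a - i)%N a.+1.
  rewrite (_ : hdist (a - i) a = i); last by rewrite /hdist; lia.
  rewrite (_ : hdist (a - i) a.+1 = i.+1); last by rewrite /hdist; lia.
  rewrite -natr1 => h1 h2.
  have {}h1 := h1 (leq_trans (leq_subr _ _) (ltnW an)) an.
  have {}h2 := h2 (leq_trans (leq_subr _ _) (ltnW an)) (ltnW an).
  have := ler_normD (phi (a - i)%N - phi a) (phi (a - i)%N - phi a.+1).
  lra.
have hB : `|B - c * V| <= L / 2 * SV.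
  rewrite /B /V /SV !mulr_sumr -sumrB; apply: le_trans (ler_norm_sum _ _ _) _.
  apply: ler_sum => i _.
  have -> : q ^+ i.+1 * phi (a.+1 + i)%N - c * q ^+ i.+1 =
     q ^+ i.+1 * (((phi (a.+1 + i)%N - phi a) + (phi (a.+1 + i)%N - phi a.+1)) / 2).
    by rewrite /c; field.
  rewrite normrM (ger0_norm (ltW (exprn_gt0 _ q0))).
  rewrite [leRHS](_ : _ = q ^+ i.+1 * (L / 2 * (2 * i%:R + 1))); last by ring.
  rewrite (ler_wpM2l (ltW (exprn_gt0 _ q0))) // normrM [`|2^-1|]ger0_norm ?invr_ge0 //.
  have iN : (a.+1 + i <= n)%N by have := ltn_ord i; lia.
  have := lip (a.+1 + i)%N a iN (ltnW an); have := lip (a.+1 + i)%N a.+1 iN an.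
  rewrite (_ : hdist (a.+1 + i) a = i.+1); last by rewrite /hdist; lia.
  rewrite (_ : hdist (a.+1 + i) a.+1 = i); last by rewrite /hdist; lia.
  rewrite -natr1 => h1 h2.
  have := ler_normD (phi (a.+1 + i)%N - phi a) (phi (a.+1 + i)%N - phi a.+1).
  lra.
have P0 : 0 < (q * U + V) * (U + V).
  by apply: mulr_gt0; apply: ltr_pwDl => //; exact: mulr_gt0.
have qUV : q * U + V != 0 by rewrite gt_eqF // ltr_pwDl ?mulr_gt0.
have UV : U + V != 0 by rewrite gt_eqF // ltr_pwDl.
(* The centring constant [c] cancels, since shifting [phi] by a constant moves both means
   equally. *)
have -> : site_mean s n a.+1 b phi - site_mean s n a b phi =
    (1 - q) * ((B - c * V) * U - (A - c * U) * V) / ((q * U + V) * (U + V)).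
  by rewrite m0 m1; field; rewrite UV qUV.
rewrite normrM normfV (gtr0_norm P0) ler_pdivrMr //.
have q1' : 0 < 1 - q by rewrite subr_gt0.
rewrite normrM (gtr0_norm q1').
have := @site_inequality R q d b N; rewrite -aE -/U -/V -/SU -/SV q0 q1 => /(_ isT) /= key.
have h : `|(B - c * V) * U - (A - c * U) * V| <= L / 2 * (SV * U + SU * V).
  apply: le_trans (ler_normB _ _) _; rewrite !normrM (gtr0_norm Upos) (ger0_norm Vpos).
  have := ler_wpM2r (ltW Upos) hB; have := ler_wpM2r Vpos hA; lra.
apply: le_trans (ler_wpM2l _ h) _; first by rewrite subr_ge0 ltW.
rewrite mulrCA ler_wpM2l //; lra.
Qed.

Lemma site_meanC {R : realFieldType} (s : R) (n a b : nat) (phi : nat -> R) :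
  site_mean s n a b phi = site_mean s n b a phi.
Proof.
have E k : site_weight s a b k = site_weight s b a k.
  by congr (_ ^+ _); rewrite /hdist; lia.
rewrite /site_mean; congr (_ / _); apply: eq_bigr => k _; rewrite E //.
Qed.

Lemma site_mean_flip {R : realFieldType} (s : R) (n a b : nat) (phi : nat -> R) :
  (a <= n)%N -> (b <= n)%N ->
  site_mean s n a b phi = site_mean s n (n - a) (n - b) (fun k => phi (n - k)%N).
Proof.
move=> an bn; rewrite /site_mean; congr (_ / _); rewrite (reindex_inj rev_ord_inj) /=;
  apply: eq_bigr => k _; rewrite subSS; have := ltn_ord k; rewrite ltnS => kn.
  by congr (_ ^+ _ * _); rewrite /hdist; lia.
by congr (_ ^+ _); rewrite /hdist; lia.
Qed.

Lemma site_mean_succ {R : realFieldType} (s : R) (n a b : nat) (phi : nat -> R) (L : R) :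
  0 < s < 1 -> (b <= n)%N -> (a < n)%N -> lipschitz_upto n phi L ->
  `|site_mean s n a.+1 b phi - site_mean s n a b phi| <= L / 2.
Proof.
move=> s01 bn an lip; case: (leqP b a) => [ba|ab]; first exact: site_mean_succ_below.
(* For [a < b], reflecting the heights puts the fixed neighbour at or below the moving one, which
   now steps from [n - a.+1] to [n - a]. *)
rewrite site_mean_flip // [X in _ - X]site_mean_flip // 1?ltnW //.
rewrite distrC (_ : (n - a = (n - a.+1).+1)%N); last by lia.
apply: site_mean_succ_below => //; try lia.
move=> k l kn ln; rewrite (_ : hdist k l = hdist (n - k) (n - l)); last by rewrite /hdist; lia.
by apply: lip; exact: leq_subr.
Qed.

Lemma site_mean_lip {R : realFieldType} (s : R) (n a a' b : nat) (phi : nat -> R) (L : R) :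
  0 < s < 1 -> (b <= n)%N -> (a <= n)%N -> (a' <= n)%N -> lipschitz_upto n phi L ->
  `|site_mean s n a b phi - site_mean s n a' b phi| <= L / 2 * (hdist a a')%:R.
Proof.
move=> s01 bn + + lip.
have H m : forall k, (k + m <= n)%N ->
    `|site_mean s n (k + m) b phi - site_mean s n k b phi| <= L / 2 * m%:R.
  elim: m => [|m IH] k km; first by rewrite addn0 subrr normr0 mulr0.
  rewrite addnS -[m.+1%:R]natr1 [leRHS]mulrDr mulr1 -(subrKA (site_mean s n (k + m) b phi)).
  apply: le_trans (ler_normD _ _) _; rewrite addrC; apply: lerD.
    by apply: IH; lia.
  by apply: site_mean_succ => //; lia.
case: (leqP a a') => [aa'|/ltnW a'a] an a'n.
  rewrite distrC -{1}(subnKC aa') (_ : hdist a a' = (a' - a)%N); last by rewrite /hdist; lia.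
  by apply: H; rewrite subnKC.
rewrite -{1}(subnKC a'a) (_ : hdist a a' = (a - a')%N); last by rewrite /hdist; lia.
by apply: H; rewrite subnKC.
Qed.

(** * Variation of a function under column updates *)

Arguments hgt : simpl never.

Lemma hgt_setcol (n : nat) (eta : config n) (i : 'I_n) (j : 'I_n.+1) (k : nat) :
  hgt (setcol eta i j) k = if k == i.+1 then nat_of_ord j else hgt eta k.
Proof.
case: k => [|k] //; rewrite /hgt; case: insubP => [l _ lk|] /=.
  by rewrite ffunE eqSS -lk val_eqE; case: ifP.
by move=> nk; case: eqP => // -[ki]; rewrite ki ltn_ord in nk.
Qed.

Lemma hgt_le (n : nat) (eta : config n) (k : nat) : (hgt eta k <= n)%N.
Proof.
by case: k => [|k] //; rewrite /hgt; case: insubP => [l _ _|] //=; rewrite -ltnS ltn_ord.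
Qed.

(** Column [i] sits at position [i.+1], so only the edges to positions [i] and [i.+2] see its
    height; [c] collects the other edges. *)
Lemma energy_setcol (n : nat) (eta : config n) (i : 'I_n) :
  exists c : nat, forall j : 'I_n.+1,
    energy (setcol eta i j) = (hdist (hgt eta i) j + hdist j (hgt eta i.+2) + c)%N.
Proof.
set i0 : 'I_n.+1 := widen_ord (leqnSn n) i; set i1 : 'I_n.+1 := lift ord0 i.
have i1E : nat_of_ord i1 = i.+1 by rewrite /i1 lift0.
exists (\sum_(k < n.+1 | (k != i0) && (k != i1)) hdist (hgt eta k) (hgt eta k.+1))%N => j.
have i10 : i1 != i0 by rewrite -val_eqE /= /bump; lia.
have i0E : nat_of_ord i0 = i by [].
have E (D : nat -> nat) : (\sum_(k < n.+1) D k =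
    D i + D i.+1 + \sum_(k < n.+1 | (k != i0) && (k != i1)) D k)%N.
  by rewrite (bigD1 i0) //= (bigD1 i1) //= addnA -[in D i.+1]i1E.
have -> : energy (setcol eta i j) =
    (\sum_(k < n.+1) hdist (hgt (setcol eta i j) k) (hgt (setcol eta i j) k.+1))%N by [].
rewrite (E (fun k => hdist (hgt _ k) (hgt _ k.+1))); congr (_ + _ + _)%N.
- by rewrite !hgt_setcol eqxx ifF //; lia.
- by rewrite !hgt_setcol eqxx ifF //; lia.
apply: eq_bigr => k /andP[k0 k1].
have {}k0 : k != i :> nat := k0.
have {}k1 : k != i.+1 :> nat by rewrite -i1E.
by rewrite !hgt_setcol !ifF //; lia.
Qed.

Lemma weight_exp {R : realType} (beta : R) (n : nat) (eta : config n) :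
  weight beta eta = expR (- beta) ^+ energy eta.
Proof. by rewrite /weight mulrC expRM_natl. Qed.

Lemma weight_gt0 {R : realType} (beta : R) (n : nat) (eta : config n) :
  0 < weight beta eta.
Proof. exact: expR_gt0. Qed.

Lemma col_probE {R : realType} (beta : R) (n : nat) (eta : config n) (i : 'I_n) (j : 'I_n.+1) :
  let w := site_weight (expR (- beta)) (hgt eta i) (hgt eta i.+2) in
  col_prob beta eta i j = w j / \sum_(k < n.+1) w k.
Proof.
move=> w; have [c cE] := energy_setcol n eta i.
have E k : weight beta (setcol eta i k) = w k * expR (- beta) ^+ c.
  by rewrite weight_exp cE exprD.
rewrite /col_prob E; under eq_bigr => k _ do rewrite E.
by rewrite -mulr_suml -mulf_div divff ?mulr1 // expf_neq0 // gt_eqF ?expR_gt0.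
Qed.

Lemma col_prob_sum {R : realType} (beta : R) (n : nat) (eta : config n) (i : 'I_n) :
  \sum_(j < n.+1) col_prob beta eta i j = 1.
Proof.
under eq_bigr => j _ do rewrite col_probE.
by rewrite -mulr_suml divff // gt_eqF ?site_weight_sum_gt0 ?expR_gt0.
Qed.

Lemma col_prob_ge0 {R : realType} (beta : R) (n : nat) (eta : config n) (i : 'I_n) (j : 'I_n.+1) :
  0 <= col_prob beta eta i j.
Proof.
by apply: divr_ge0; [|apply: sumr_ge0 => k _]; exact/ltW/weight_gt0.
Qed.

Lemma col_meanE {R : realType} (beta : R) (n : nat) (eta : config n) (i : 'I_n)
    (F : 'I_n.+1 -> R) :
  \sum_(j < n.+1) col_prob beta eta i j * F j =
  site_mean (expR (- beta)) n (hgt eta i) (hgt eta i.+2) (fun k => F (inord k)).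
Proof.
rewrite /site_mean mulr_suml; apply: eq_bigr => j _.
by rewrite col_probE inord_val mulrAC.
Qed.

Definition adj_sites (n : nat) (i k : 'I_n) : bool := (i.+1 == k :> nat) || (k.+1 == i :> nat).

(** The update in its action on test functions, dual to its action on laws. *)
Definition col_update {R : realType} (beta : R) {n : nat} (i : 'I_n) (f : config n -> R) :
    config n -> R :=
  fun eta => \sum_(j < n.+1) col_prob beta eta i j * f (setcol eta i j).

Definition col_updates {R : realType} (beta : R) {n : nat} (s : seq 'I_n) (f : config n -> R) :
    config n -> R :=
  foldr (col_update beta) f s.

Lemma setcol_idem (n : nat) (eta : config n) (i : 'I_n) (j k : 'I_n.+1) :
  setcol (setcol eta i j) i k = setcol eta i k.
Proof. by apply/ffunP => l; rewrite !ffunE; case: eqP. Qed.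

Lemma setcolC (n : nat) (eta : config n) (i m : 'I_n) (j k : 'I_n.+1) :
  m != i -> setcol (setcol eta m j) i k = setcol (setcol eta i k) m j.
Proof.
move=> mi; apply/ffunP => l; rewrite !ffunE.
by case: (eqVneq l i) => // ->; rewrite eq_sym (negbTE mi).
Qed.

Lemma setcol_id (n : nat) (eta : config n) (i : 'I_n) : setcol eta i (eta i) = eta.
Proof. by apply/ffunP => l; rewrite !ffunE; case: eqP => // ->. Qed.

(** The bound is kept separately for each column, so that the spread of variation to neighbours can
    be followed. *)
Definition col_lip {R : realType} {n : nat} (f : config n -> R) (L : 'I_n -> R) : Prop :=
  forall (eta : config n) (i : 'I_n) (j j' : 'I_n.+1),
    `|f (setcol eta i j) - f (setcol eta i j')| <= L i * (hdist j j')%:R.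

Lemma col_lip_le {R : realType} (n : nat) (f : config n -> R) (L L' : 'I_n -> R) :
  col_lip f L -> (forall i, L i <= L' i) -> col_lip f L'.
Proof. by move=> lf LL eta i j j'; apply: le_trans (lf _ _ _ _) _; rewrite ler_wpM2r. Qed.

Lemma col_prob_setcol {R : realType} (beta : R) (n : nat) (eta : config n) (i m : 'I_n)
    (j k : 'I_n.+1) :
  ~~ adj_sites n m i -> col_prob beta (setcol eta m j) i k = col_prob beta eta i k.
Proof.
rewrite negb_or => /andP[mi im]; rewrite !col_probE !hgt_setcol !ifF //; lia.
Qed.

(** Moving column [k] changes [f] at a fixed drawn height, at cost [L k], and for a neighbour of [i]
    also the law of that height, at cost [L i / 2] by [site_mean_lip]. The old height of column [i]
    is overwritten, hence forgotten. *)
Lemma col_lip_col_update {R : realType} (beta : R) (n : nat) (i : 'I_n) (f : config n -> R)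
    (L : 'I_n -> R) :
  0 < beta -> col_lip f L ->
  col_lip (col_update beta i f)
    (fun k => if k == i then 0 else L k + (adj_sites n k i)%:R * (L i / 2)).
Proof.
move=> b0 lf eta m j j'; rewrite /col_update.
have [->|mi] := eqVneq m i.
  rewrite mul0r normr_le0 subr_eq0; apply/eqP/eq_bigr => k _.
  by rewrite !setcol_idem !col_probE !hgt_setcol !ifF //; lia.
set p := col_prob beta (setcol eta m j) i; set p' := col_prob beta (setcol eta m j') i.
(* Evaluating both laws on the same [F] separates the change of [f] from the change of law. *)
pose F k := f (setcol (setcol eta m j') i k).
have -> : \sum_(k < n.+1) p k * f (setcol (setcol eta m j) i k)
    - \sum_(k < n.+1) p' k * f (setcol (setcol eta m j') i k) =
    \sum_(k < n.+1) p k * (f (setcol (setcol eta m j) i k) - F k) +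
    (\sum_(k < n.+1) p k * F k - \sum_(k < n.+1) p' k * F k).
  by under [X in _ = X + _]eq_bigr => k _ do rewrite mulrBr; rewrite sumrB addrA subrK.
apply: le_trans (ler_normD _ _) _; rewrite mulrDl; apply: lerD.
  apply: le_trans (ler_norm_sum _ _ _) _.
  have -> : L m * (hdist j j')%:R = \sum_(k < n.+1) p k * (L m * (hdist j j')%:R).
    by rewrite -mulr_suml col_prob_sum mul1r.
  apply: ler_sum => k _; rewrite normrM ger0_norm ?col_prob_ge0 //.
  rewrite ler_wpM2l ?col_prob_ge0 // /F !(setcolC _ _ _ _ _ _ mi); exact: lf.
have s01 : 0 < expR (- beta) < 1 by rewrite expR_gt0 expR_lt1 oppr_lt0.
have lF : lipschitz_upto n (fun k => F (inord k)) (L i).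
  move=> k l kn ln; apply: le_trans (lf _ _ _ _) _.
  by rewrite !inordK.
have jn := ltn_ord j; have jn' := ltn_ord j'; rewrite !ltnS in jn jn'.
have E1 : \sum_(k < n.+1) p k * F k = _ := col_meanE beta n (setcol eta m j) i F.
have E2 : \sum_(k < n.+1) p' k * F k = _ := col_meanE beta n (setcol eta m j') i F.
clearbody p p'; rewrite {}E1 {}E2.
rewrite !hgt_setcol /adj_sites.
case: (eqVneq m.+1 (i : nat)) => [mE|mE] /=.
  rewrite ifF; last by lia.
  rewrite ifF; last by lia.
  by rewrite mul1r; apply: site_mean_lip => //; exact: hgt_le.
case: (eqVneq i.+1 (m : nat)) => [iE|iE]; last first.
  by rewrite !ifF ?subrr ?normr0 ?mul0r //; lia.
rewrite !ifT; [|by rewrite iE..].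
(* The moved column is the right neighbour here; symmetry brings it to the argument varied in
   [site_mean_lip]. *)
rewrite ![site_mean _ _ (hgt _ _) _ _]site_meanC.
by rewrite mul1r; apply: site_mean_lip => //; exact: hgt_le.
Qed.

Definition independent_sites {n : nat} (s : seq 'I_n) : Prop :=
  forall i k, i \in s -> k \in s -> ~~ adj_sites n i k.

(** As no two sites of [s] are adjacent, updated sites receive nothing from one another, and each
    passes on half of its original [L i]. *)
Lemma col_lip_col_updates {R : realType} (beta : R) (n : nat) (s : seq 'I_n) (f : config n -> R)
    (L : 'I_n -> R) :
  0 < beta -> uniq s -> independent_sites s -> col_lip f L ->
  col_lip (col_updates beta s f)
    (fun k => if k \in s then 0 else L k + \sum_(i <- s) (adj_sites n k i)%:R * (L i / 2)).
Proof.
move=> b0 + + lf; elim: s => [|i s IH] /=.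
  by move=> _ _; apply: col_lip_le lf _ => k; rewrite big_nil addr0.
move=> /andP[is_ us] ind.
have ind' : independent_sites s by move=> k l ks ls; apply: ind; rewrite inE ?ks ?ls orbT.
have {}IH := IH us ind'.
apply: col_lip_le (col_lip_col_update _ _ i _ _ b0 IH) _ => k.
rewrite inE; case: eqP => //= ki; rewrite (negbTE is_).
have zi : \sum_(l <- s) (adj_sites n i l)%:R * (L l / 2) = 0.
  rewrite big_seq big1 // => l ls; rewrite (negbTE (ind _ _ _ _)) ?mul0r //.
    by rewrite mem_head.
  by rewrite inE ls orbT.
rewrite zi addr0; case: (boolP (k \in s)) => ks.
  by rewrite (negbTE (ind _ _ _ _)) ?inE ?ks ?eqxx ?orbT // mul0r addr0.
by rewrite big_cons -addrA [X in _ + X]addrC.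
Qed.

(** * Simultaneous updates and invariance of the Gibbs measure *)

Definition par_op {R : realType} (beta : R) {n : nat} (S : pred 'I_n) (f : config n -> R) :
    config n -> R :=
  fun eta => \sum_(z : config n) par_kernel beta S eta z * f z.

(* Updates at pairwise non-adjacent sites do not see each other, so the simultaneous
   update is the composition of the single ones. *)
Lemma par_op_col_updates {R : realType} (beta : R) (n : nat) (s : seq 'I_n) (f : config n -> R)
    (eta : config n) :
  uniq s -> independent_sites s -> par_op beta (fun i => i \in s) f eta = col_updates beta s f eta.
Proof.
rewrite /par_op; elim: s eta => [|i s IH] eta /=.
  move=> _ _; rewrite (bigD1 eta) //= big1 ?addr0.
    by rewrite /par_kernel ifT ?big_pred0 ?mul1r //; apply/forallP => k; rewrite eqxx implybT.
  move=> z zeta; rewrite /par_kernel ifF ?mul0r //; apply/negbTE.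
  apply: contra zeta => /forallP h; apply/eqP/ffunP => k; exact/eqP/h.
move=> /andP[is_ us] ind.
have ind' : independent_sites s by move=> k l ks ls; apply: ind; rewrite inE ?ks ?ls orbT.
rewrite /col_update [RHS](eq_bigr (fun j => \sum_(z : config n) col_prob beta eta i j *
    (par_kernel beta (fun k => k \in s) (setcol eta i j) z * f z))); last first.
  by move=> j _; rewrite -IH // mulr_sumr.
rewrite exchange_big /=; apply: eq_bigr => z _.
under eq_bigr => j _ do rewrite mulrA.
rewrite -mulr_suml; congr (_ * _).
rewrite (bigD1 (z i)) //= big1 ?addr0; last first.
  move=> j jz; rewrite /par_kernel ifF ?mulr0 //; apply/negbTE/forallPn; exists i.
  by rewrite is_ /= ffunE eqxx eq_sym.
rewrite /par_kernel.
have -> : [forall k, (k \notin s) ==> (z k == setcol eta i (z i) k)] =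
          [forall k, (k \notin i :: s) ==> (z k == eta k)].
  apply: eq_forallb => k; rewrite inE ffunE.
  by case: (eqVneq k i) => [->|ki] //=; rewrite eqxx implybT.
case: [forall k, _]; last by rewrite mulr0.
rewrite (bigD1 i) /=; last by rewrite inE eqxx.
congr (_ * _); apply: eq_big => k.
  by rewrite inE; case: (eqVneq k i) => [->|ki] //=; rewrite ?andbT // (negbTE is_).
rewrite inE => /andP[ks ki]; rewrite col_prob_setcol //.
by apply: ind; rewrite ?inE ?eqxx // orbC (negbTE ki) orbF in ks *.
Qed.

(** Reversibility: on pairs of a configuration and a drawn height, exchanging the drawn height with
    the old one is an involution preserving weight times transition probability. *)
Lemma gibbs_col_update {R : realType} (beta : R) (n : nat) (i : 'I_n) (f : config n -> R) :
  \sum_(z : config n) gibbs beta z * col_update beta i f z = \sum_(z : config n) gibbs beta z * f z.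
Proof.
pose W (z : config n) := weight beta z.
suff H : \sum_(z : config n) W z * col_update beta i f z = \sum_(z : config n) W z * f z.
  rewrite /gibbs; under eq_bigr => z _ do rewrite mulrAC.
  by under [RHS]eq_bigr => z _ do rewrite mulrAC; rewrite -!mulr_suml H.
transitivity (\sum_(z : config n) \sum_(j < n.+1)
    W z * (col_prob beta z i j * f (setcol z i j))).
  by apply: eq_bigr => z _; rewrite /col_update mulr_sumr.
transitivity (\sum_(z : config n) \sum_(j < n.+1) col_prob beta z i j * (W z * f z));
  last by apply: eq_bigr => z _; rewrite -mulr_suml col_prob_sum mul1r.
rewrite !pair_bigA /=.
pose h (p : config n * 'I_n.+1) := (setcol p.1 i p.2, p.1 i).
have hK : involutive h by move=> [z j]; rewrite /h /= setcol_idem setcol_id ffunE eqxx.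
rewrite (reindex_inj (inv_inj hK)) /=; apply: eq_bigr => -[z j] _ /=.
rewrite setcol_idem setcol_id /col_prob setcol_idem setcol_id.
under eq_bigr => k _ do rewrite setcol_idem.
by rewrite /W; ring.
Qed.

Lemma gibbs_col_updates {R : realType} (beta : R) (n : nat) (s : seq 'I_n) (f : config n -> R) :
  \sum_(z : config n) gibbs beta z * col_updates beta s f z =
  \sum_(z : config n) gibbs beta z * f z.
Proof. by elim: s => //= i s IH; rewrite gibbs_col_update. Qed.

(** * Alternating updates *)

(** [true] selects the odd positions; the Boolean lets both update orders be treated at once. *)
Definition parity_sites (n : nat) (p : bool) : pred 'I_n := fun i => odd i.+1 == p.

Definition parity_op {R : realType} (beta : R) {n : nat} (p : bool) (f : config n -> R) :
    config n -> R :=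
  par_op beta (parity_sites n p) f.

Definition parity_seq (n : nat) (p : bool) : seq 'I_n :=
  [seq i <- enum 'I_n | parity_sites n p i].

Lemma mem_parity_seq (n : nat) (p : bool) (i : 'I_n) :
  (i \in parity_seq n p) = parity_sites n p i.
Proof. by rewrite mem_filter mem_enum andbT. Qed.

Lemma adjacent_parity (n : nat) (p : bool) (i k : 'I_n) :
  adj_sites n i k -> parity_sites n p i = ~~ parity_sites n p k.
Proof. by rewrite /adj_sites /parity_sites; case: p => /orP[] /eqP <- /=; case: odd. Qed.

Lemma parity_seq_independent (n : nat) (p : bool) : independent_sites (parity_seq n p).
Proof.
move=> i k; rewrite !mem_parity_seq => pi pk; apply/negP => /(adjacent_parity _ p).
by rewrite pi pk.
Qed.

Lemma parity_op_col_updates {R : realType} (beta : R) (n : nat) (p : bool) (f : config n -> R) :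
  parity_op beta p f = col_updates beta (parity_seq n p) f.
Proof.
have e : parity_sites n p = (fun i => i \in parity_seq n p).
  by apply/funext => i; rewrite mem_parity_seq.
apply/funext => eta; rewrite /parity_op e; apply: par_op_col_updates.
  by rewrite filter_uniq // enum_uniq.
exact: parity_seq_independent.
Qed.

Lemma gibbs_parity_op {R : realType} (beta : R) (n : nat) (p : bool) (f : config n -> R) :
  \sum_(z : config n) gibbs beta z * parity_op beta p f z =
  \sum_(z : config n) gibbs beta z * f z.
Proof. by rewrite parity_op_col_updates gibbs_col_updates. Qed.

(** * The superharmonic profile and the contraction *)

Lemma sum_adjacent {R : realType} (n : nat) (k : 'I_n) (F : nat -> R) :
  \sum_(i < n) (adj_sites n k i)%:R * F i =
  (if (0 < k)%N then F k.-1 else 0) + (if (k.+1 < n)%N then F k.+1 else 0).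
Proof.
have single m : \sum_(i < n) (i == m :> nat)%:R * F i = if (m < n)%N then F m else 0.
  rewrite -(big_ord1_eq +%R F m n) [RHS]big_mkcond; apply: eq_bigr => i _.
  by case: ifP; rewrite ?mul1r ?mul0r.
rewrite -single; case: (posnP k) => [k0|k0] /=.
  rewrite add0r; apply: eq_bigr => i _; rewrite /adj_sites k0.
  by rewrite orbF eq_sym.
have -> : F k.-1 = \sum_(i < n) (i == k.-1 :> nat)%:R * F i.
  by rewrite single ifT //; have := ltn_ord k; lia.
rewrite -big_split; apply: eq_bigr => i _ /=; rewrite -mulrDl -natrD; congr (_%:R * _).
rewrite /adj_sites; lia.
Qed.

(** At position [i = k.+1] this is the parabola [i * (n + 1 - i)]. *)
Definition site_height {R : realType} (n k : nat) : R := k.+1%:R * (n - k)%:R.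

Lemma site_height_ge1 {R : realType} (n : nat) (k : 'I_n) : 1 <= site_height n k :> R.
Proof. by rewrite /site_height -natrM ler1n muln_gt0 /= subn_gt0. Qed.

Lemma site_height_le {R : realType} (n : nat) (k : 'I_n) : site_height n k <= n%:R ^+ 2 :> R.
Proof. by rewrite /site_height -natrM -natrX ler_nat expnS expn1 leq_mul // leq_subr. Qed.

(** The second difference of the parabola is -2, and it vanishes at both boundary positions, so the
    end columns need no correction. *)
Lemma sum_adjacent_site_height {R : realType} (n : nat) (k : 'I_n) :
  \sum_(i < n) (adj_sites n k i)%:R * site_height n i = 2 * (site_height n k - 1) :> R.
Proof.
rewrite sum_adjacent /site_height.
have [m nE] : exists m, n = (k + m).+1.
  by exists (n - k.+1)%N; rewrite -addSn subnKC.
rewrite (_ : (n - k = m.+1)%N); last by lia.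
rewrite (_ : (n - k.+1 = m)%N); last by lia.
have -> : (if (k.+1 < n)%N then k.+2%:R * m%:R else 0) = k.+2%:R * m%:R :> R.
  case: ifP => // h; rewrite (_ : m = 0%N) ?mulr0 //; lia.
have -> : (if (0 < k)%N then k.-1.+1%:R * (n - k.-1)%:R else 0) = k%:R * m.+2%:R :> R.
  case: ifP => h; last by rewrite (_ : k = 0%N :> nat) ?mul0r //; lia.
  by rewrite prednK // (_ : (n - k.-1 = m.+2)%N) //; lia.
by rewrite -[k.+2%:R]natr1 -[m.+2%:R]natr1 -[k.+1%:R]natr1 -[m.+1%:R]natr1; ring.
Qed.

Definition contraction {R : realType} (n : nat) : R := 1 - (n%:R ^+ 2)^-1.

Lemma contraction_itv {R : realType} (n : nat) : (0 < n)%N -> 0 <= (contraction n : R) <= 1.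
Proof.
move=> n0; rewrite /contraction subr_ge0 invf_le1 ?exprn_gt0 ?ltr0n //.
by rewrite gerBl invr_ge0 exprn_ge0 // andbT -natrX ler1n expn_gt0 n0.
Qed.

(** Support on one parity suffices: after an update of the other parity, the function no longer
    depends on those columns. *)
Definition parity_profile {R : realType} (n : nat) (p : bool) (c : R) : 'I_n -> R :=
  fun k => if parity_sites n p k then c * site_height n k else 0.

Lemma parity_sitesN (n : nat) (p : bool) (i : 'I_n) :
  parity_sites n (~~ p) i = ~~ parity_sites n p i.
Proof. by rewrite /parity_sites; case: p; case: odd. Qed.

Lemma sum_parity_seq_le {R : realType} (n : nat) (p : bool) (G : 'I_n -> R) :
  (forall i, 0 <= G i) -> \sum_(i <- parity_seq n p) G i <= \sum_(i < n) G i.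
Proof.
move=> G0; rewrite big_filter big_enum_cond big_mkcond.
by apply: ler_sum => i _; case: ifP.
Qed.

(** Averaging over neighbours lowers the parabola by 1, at least a share [1 / n^2] of it because it
    never exceeds [n^2]. *)
Lemma col_lip_parity_op {R : realType} (beta : R) (n : nat) (p : bool) (f : config n -> R)
    (c : R) :
  0 < beta -> 0 <= c -> col_lip f (parity_profile n p c) ->
  col_lip (parity_op beta p f) (parity_profile n (~~ p) (c * contraction n)).
Proof.
move=> b0 c0 lf; rewrite parity_op_col_updates.
apply: col_lip_le (col_lip_col_updates _ _ _ _ _ b0 _ _ lf) _.
- by rewrite filter_uniq ?enum_uniq.
- exact: parity_seq_independent.
move=> k; rewrite mem_parity_seq /parity_profile parity_sitesN.
case: (boolP (parity_sites n p k)) => //= _.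
rewrite add0r.
have h0 (i : 'I_n) : 0 <= site_height n i :> R := le_trans ler01 (site_height_ge1 n i).
apply: (@le_trans _ _ (\sum_(i < n) (adj_sites n k i)%:R * (c / 2 * site_height n i))).
  apply: le_trans (sum_parity_seq_le n p _ _).
    apply: ler_sum => i _; rewrite ler_wpM2l // mulrAC.
    by case: ifP => // _; rewrite mul0r mulr_ge0 // mulr_ge0.
  by move=> i; rewrite !mulr_ge0 // ?invr_ge0.
have -> : \sum_(i < n) (adj_sites n k i)%:R * (c / 2 * site_height n i) =
    c / 2 * \sum_(i < n) (adj_sites n k i)%:R * site_height n i.
  by rewrite mulr_sumr; apply: eq_bigr => i _; rewrite mulrCA.
rewrite sum_adjacent_site_height (_ : c / 2 * _ = c * (site_height n k - 1)); last by field.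
rewrite -mulrA ler_wpM2l // /contraction mulrBl mul1r lerB // mulrC.
rewrite ler_pdivrMr ?mul1r ?site_height_le // exprn_gt0 // ltr0n.
exact: leq_ltn_trans (ltn_ord k).
Qed.

(** A column that is not updated keeps its own 2 and receives 1 from each of at most two neighbours,
    while the parabola is at least 1. *)
Lemma col_lip_parity_op_first {R : realType} (beta : R) (n : nat) (p : bool)
    (f : config n -> R) :
  0 < beta -> col_lip f (fun=> 2) ->
  col_lip (parity_op beta p f) (parity_profile n (~~ p) 4).
Proof.
move=> b0 lf; rewrite parity_op_col_updates.
apply: col_lip_le (col_lip_col_updates _ _ _ _ _ b0 _ _ lf) _.
- by rewrite filter_uniq ?enum_uniq.
- exact: parity_seq_independent.
move=> k; rewrite mem_parity_seq /parity_profile parity_sitesN.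
case: (boolP (parity_sites n p k)) => //= _.
have := sum_parity_seq_le n p (fun i => (adj_sites n k i)%:R * (2 / 2) : R).
move=> /(_ (fun i => _)) h; apply: le_trans (lerD (lexx _) (h _)) _.
  by move=> i; rewrite mulr_ge0.
rewrite (sum_adjacent n k (fun=> 2 / 2)); have := @site_height_ge1 R n k.
by do 2 case: ifP => _; lra.
Qed.

(** Turn [x] into [y] one column at a time; each change moves a height by at most [n]. *)
Lemma col_lip_osc {R : realType} (n : nat) (f : config n -> R) (L : 'I_n -> R)
    (x y : config n) :
  col_lip f L -> (forall i, 0 <= L i) -> `|f x - f y| <= n%:R * \sum_(i < n) L i.
Proof.
move=> lf L0.
pose g s := foldr (fun i z => setcol z i (y i)) x s.
have gE s i : g s i = if i \in s then y i else x i.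
  elim: s => [|k s IH] //=; rewrite ffunE inE IH; case: eqP => //= -> //.
have -> : y = g (enum 'I_n) by apply/ffunP => i; rewrite gE mem_enum.
rewrite mulr_sumr -big_enum /=; elim: (enum 'I_n) => [|i s IH] /=.
  by rewrite subrr normr0 big_nil.
rewrite big_cons -(subrKA (f (g s))) addrC; apply: le_trans (ler_normD _ _) _; apply: lerD => //.
rewrite -[X in f X - _](setcol_id _ (g s) i); apply: le_trans (lf _ _ _ _) _.
rewrite mulrC ler_wpM2r // ler_nat /hdist.
by have := ltn_ord (g s i); have := ltn_ord (y i); lia.
Qed.

Lemma col_lip_bounded {R : realType} (n : nat) (f : config n -> R) :
  (forall z, `|f z| <= 1) -> col_lip f (fun=> 2).
Proof.
move=> f1 eta i j j'; have [->|jj] := eqVneq j j'.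
  by rewrite subrr normr0 mulr_ge0.
apply: le_trans (ler_normB _ _) _; apply: (@le_trans _ _ 2).
  by have := f1 (setcol eta i j); have := f1 (setcol eta i j'); lra.
rewrite ler_peMr // ler1n /hdist; move: jj; rewrite -val_eqE /=; lia.
Qed.

(** Duality reverses the order: the outermost operator is the update performed first. *)
Definition alt_op {R : realType} (beta : R) {n : nat} (p : bool) (f : config n -> R) :
    config n -> R :=
  parity_op beta p (parity_op beta (~~ p) f).

(** The first round turns the uniform bound 2 into the profile with constant 4, its contraction
    being dropped. Each later round contracts twice, and one factor is kept. *)
Lemma col_lip_alt_op {R : realType} (beta : R) (n : nat) (p : bool) (f : config n -> R)
    (t : nat) :
  0 < beta -> (0 < n)%N -> (forall z, `|f z| <= 1) ->
  col_lip (iter t.+1 (alt_op beta p) f) (parity_profile n (~~ p) (4 * contraction n ^+ t)).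
Proof.
move=> b0 n0 f1; have /andP[r0 r1] := @contraction_itv R n n0.
have weaken q (c c' : R) (g : config n -> R) : c <= c' -> col_lip g (parity_profile n q c) ->
    col_lip g (parity_profile n q c').
  move=> cc lg; apply: col_lip_le lg _ => k; rewrite /parity_profile; case: ifP => // _.
  by rewrite ler_wpM2r // (le_trans ler01) // site_height_ge1.
elim: t => [|t IH].
  apply: (weaken _ (4 * contraction n)); first by rewrite expr0 ler_wpM2l.
  apply: col_lip_parity_op => //; have := col_lip_bounded _ _ f1.
  by move/(col_lip_parity_op_first _ _ (~~ p) _ b0); rewrite negbK.
rewrite iterS; set g := iter _ _ _ in IH *.
have c0 : 0 <= 4 * contraction n ^+ t :> R by rewrite mulr_ge0 // exprn_ge0.
apply: (weaken _ (4 * contraction n ^+ t * contraction n * contraction n)).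
  by rewrite exprSr mulrA ler_piMr // mulr_ge0.
apply: col_lip_parity_op => //; first by rewrite mulr_ge0.
by have := col_lip_parity_op _ _ _ _ _ b0 c0 IH; rewrite negbK.
Qed.

(** * Duality and the total variation bound *)

Definition alt_law {R : realType} (beta : R) {n : nat} (p : bool) (t : nat) (x : config n) :
    config n -> R :=
  iter t (fun nu => step_law (par_kernel beta (parity_sites n (~~ p)))
                     (step_law (par_kernel beta (parity_sites n p)) nu)) (Defs.dirac R x).

Lemma law_OE_alt {R : realType} (beta : R) (n : nat) : @law_OE R beta n = alt_law beta true.
Proof.
have e1 : @oddpos n = parity_sites n true.
  by apply/funext => i; rewrite /oddpos /parity_sites eqb_id.
have e2 : @evenpos n = parity_sites n false.
  by apply/funext => i; rewrite /evenpos /parity_sites eqbF_neg.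
by rewrite /law_OE e1 e2.
Qed.

Lemma law_EO_alt {R : realType} (beta : R) (n : nat) : @law_EO R beta n = alt_law beta false.
Proof.
have e1 : @oddpos n = parity_sites n true.
  by apply/funext => i; rewrite /oddpos /parity_sites eqb_id.
have e2 : @evenpos n = parity_sites n false.
  by apply/funext => i; rewrite /evenpos /parity_sites eqbF_neg.
by rewrite /law_EO e1 e2.
Qed.

Lemma step_law_dual {R : realType} (beta : R) (n : nat) (p : bool) (nu f : config n -> R) :
  \sum_(y : config n) step_law (par_kernel beta (parity_sites n p)) nu y * f y =
  \sum_(x : config n) nu x * parity_op beta p f x.
Proof.
rewrite /step_law; under eq_bigr => y _ do rewrite mulr_suml.
rewrite exchange_big /=; apply: eq_bigr => x _.
by rewrite mulr_sumr; apply: eq_bigr => y _; rewrite mulrA.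
Qed.

Lemma alt_law_dual {R : realType} (beta : R) (n : nat) (p : bool) (t : nat) (x : config n)
    (f : config n -> R) :
  \sum_(y : config n) alt_law beta p t x y * f y = iter t (alt_op beta p) f x.
Proof.
elim: t f => [|t IH] f.
  rewrite /alt_law /Defs.dirac /= (bigD1 x) //= eqxx mul1r big1 ?addr0 // => y yx.
  by rewrite (negbTE yx) mul0r.
by rewrite /alt_law iterS !step_law_dual -/(alt_law beta p t x) IH iterSr.
Qed.

Lemma gibbs_alt_op {R : realType} (beta : R) (n : nat) (p : bool) (t : nat)
    (f : config n -> R) :
  \sum_(z : config n) gibbs beta z * iter t (alt_op beta p) f z =
  \sum_(z : config n) gibbs beta z * f z.
Proof. by elim: t => //= t IH; rewrite /alt_op !gibbs_parity_op. Qed.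

Lemma weight_sum_gt0 {R : realType} (beta : R) (n : nat) :
  0 < \sum_(z : config n) weight beta z.
Proof.
rewrite (bigD1 [ffun=> ord0]) //=; apply: ltr_pwDl; first exact: weight_gt0.
by apply: sumr_ge0 => z _; exact/ltW/weight_gt0.
Qed.

(** By duality and invariance, the left side compares the iterated function at [x] with its Gibbs
    mean, so its oscillation is a bound. In [n^4], one [n] is the range of a height, one the number
    of columns, and [n^2] bounds the parabola. *)
Lemma alt_law_test {R : realType} (beta : R) (n : nat) (p : bool) (t : nat) (x : config n)
    (f : config n -> R) :
  0 < beta -> (0 < n)%N -> (forall z, `|f z| <= 1) ->
  `|\sum_(y : config n) (alt_law beta p t.+1 x y - gibbs beta y) * f y| <=
  4 * n%:R ^+ 4 * contraction n ^+ t.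
Proof.
move=> b0 n0 f1; have /andP[r0 _] := @contraction_itv R n n0.
have g0 (z : config n) : 0 <= gibbs beta z.
  by apply: divr_ge0; apply: ltW; [exact: weight_gt0|exact: weight_sum_gt0].
have g1 : \sum_(z : config n) gibbs beta z = 1.
  by rewrite -mulr_suml divff // gt_eqF // weight_sum_gt0.
under eq_bigr => y _ do rewrite mulrBl.
rewrite sumrB alt_law_dual -(gibbs_alt_op beta n p t.+1).
set g := iter _ _ _.
have lg : col_lip g _ := col_lip_alt_op beta n p f t b0 n0 f1.
have -> : g x = \sum_(z : config n) gibbs beta z * g x by rewrite -mulr_suml g1 mul1r.
rewrite -sumrB.
apply: le_trans (ler_norm_sum _ _ _) _.
set M := 4 * _ * _.
have -> : M = \sum_(z : config n) gibbs beta z * M by rewrite -mulr_suml g1 mul1r.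
apply: ler_sum => z _; rewrite -mulrBr normrM ger0_norm // ler_wpM2l // {}/M.
set c := 4 * contraction n ^+ t in lg *.
have c0 : 0 <= c by rewrite mulr_ge0 // exprn_ge0.
have p0 i : 0 <= parity_profile n (~~ p) c i.
  rewrite /parity_profile; case: ifP => // _.
  by rewrite mulr_ge0 // (le_trans ler01) // site_height_ge1.
apply: le_trans (col_lip_osc _ _ _ _ _ lg p0) _.
rewrite (_ : 4 * _ * _ = n%:R * (n%:R * (c * n%:R ^+ 2))); last by rewrite /c; ring.
rewrite ler_wpM2l // -[X in _ <= X * _](_ : \sum_(i < n) 1 = n%:R :> R); last first.
  by rewrite sumr_const card_ord.
rewrite mulr_suml; apply: ler_sum => i _; rewrite mul1r /parity_profile.
case: ifP => _; first by rewrite ler_wpM2l // site_height_le.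
by rewrite mulr_ge0 // exprn_ge0.
Qed.

Lemma par_law_tv {R : realType} (beta : R) (n : nat) (t : nat) (x : config n) :
  0 < beta -> (0 < n)%N ->
  tv_dist (par_law beta t.+1 x) (gibbs beta (n:=n)) <= 2 * n%:R ^+ 4 * contraction n ^+ t.
Proof.
move=> b0 n0; rewrite /tv_dist.
(* The sign as test function makes the sum of absolute values linear in the law, so the two update
   orders can be estimated separately. *)
pose f z := Num.sg (par_law beta t.+1 x z - gibbs beta z).
have f1 z : `|f z| <= 1 by rewrite /f normr_sg; case: eqP.
have -> : \sum_y `|par_law beta t.+1 x y - gibbs beta y| =
   2^-1 * \sum_y (alt_law beta true t.+1 x y - gibbs beta y) * f y
   + 2^-1 * \sum_y (alt_law beta false t.+1 x y - gibbs beta y) * f y.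
  rewrite !mulr_sumr -big_split; apply: eq_bigr => y _.
  rewrite -[RHS]/(2^-1 * ((alt_law beta true t.+1 x y - gibbs beta y) * f y) +
    2^-1 * ((alt_law beta false t.+1 x y - gibbs beta y) * f y)).
  by rewrite normrEsg -/(f y) /par_law law_OE_alt law_EO_alt; field.
have := alt_law_test beta n true t x f b0 n0 f1.
have := alt_law_test beta n false t x f b0 n0 f1.
rewrite !ler_norml => /andP[_ h1] /andP[_ h2]; lra.
Qed.

(** * Choice of the number of steps *)

Lemma contraction_exp_le {R : realType} (n t : nat) :
  (0 < n)%N -> contraction n ^+ t <= expR (- (t%:R / n%:R ^+ 2)) :> R.
Proof.
move=> n0; have /andP[r0 _] := @contraction_itv R n n0.
rewrite -mulrN expRM_natl lerXn2r ?nnegrE ?expR_ge0 //.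
exact: expR_ge1Dx.
Qed.

(* mixing time t_mix(n) = least t with mixed_by beta n t;
   "t_mix(n) = O(n^2 log n)" is stated as: there are C, N such that for
   every n >= N some t <= C n^2 ln n satisfies mixed_by (so the least such t
   is <= C n^2 ln n). *)
Theorem theorem3p4 (R : realType) (beta : R) :
  0 < beta ->
  exists C : R, exists N : nat, forall n : nat, (N <= n)%N ->
    exists t : nat, t%:R <= C * n%:R ^+ 2 * ln (n%:R : R) /\ mixed_by beta n t.
Proof.
(* The constant 8 gives a decay [n^-8], which beats the factor [n^4]; [n >= 4] gives [ln n >= 1] and
   the final numerical comparison. *)
move=> b0; exists 8, 4%N => n n4.
have n0 : (0 < n)%N by apply: leq_trans n4.
have nR : 4 <= n%:R :> R by rewrite ler_nat.
have nR0 : 0 < n%:R :> R by rewrite ltr0n.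
(* From [expR (- 2^-1) >= 2^-1] follows [expR 2^-1 <= 2], which is then squared. *)
have e_le4 : expR 1 <= 4 :> R.
  have h := expR_ge1Dx (- 2^-1 : R).
  rewrite expRN in h.
  have h0 : 0 < expR 2^-1 :> R := expR_gt0 _.
  have {}h : expR 2^-1 <= 2 :> R.
    have := ler_wpM2l (ltW h0) h; rewrite divff ?gt_eqF //; lra.
  rewrite (_ : 1 = 2^-1 + 2^-1 :> R); last by field.
  rewrite expRD; nra.
have e0 : 0 < expR 1 :> R := expR_gt0 _.
have ln1 : 1 <= ln (n%:R : R).
  by rewrite -[leLHS]expRK ler_ln ?posrE // (le_trans e_le4).
set T : R := 8 * n%:R ^+ 2 * ln n%:R.
have T1 : 1 <= T.
  have : 1 <= n%:R ^+ 2 :> R by rewrite -natrX ler1n expn_gt0 n0.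
  by rewrite /T; nra.
have T0 : 0 <= T by apply: le_trans T1.
have [t tE] : exists t, Num.truncn T = t.+1.
  by exists (Num.truncn T).-1; rewrite prednK // truncn_gt0.
have := truncn_itv T0; rewrite tE => /andP[tT Tt].
exists t.+1; split=> // x; apply: le_trans (par_law_tv _ _ _ _ b0 n0) _.
have n20 : 0 < n%:R ^+ 2 :> R by rewrite exprn_gt0.
(* Since [T < t + 2], rounding and the shift by one step cost a factor of at most [expR 2]. *)
have rate : contraction n ^+ t <= expR 2 / n%:R ^+ 8 :> R.
  apply: le_trans (contraction_exp_le _ _ n0) _.
  have -> : expR 2 / n%:R ^+ 8 = expR (2 - 8 * ln n%:R) :> R.
    by rewrite [RHS]expRD expRN expRM_natl lnK // posrE.
  rewrite ler_expR.
  have : 8 * ln n%:R <= (t%:R + 2) / n%:R ^+ 2 :> R.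
    rewrite ler_pdivlMr // mulrAC -/T; move: Tt; rewrite -2!natr1; lra.
  rewrite mulrDl.
  have : 2 / n%:R ^+ 2 <= 2 :> R.
    by rewrite ler_pdivrMr // ler_peMr // -natrX ler1n expn_gt0 n0.
  lra.
have N0 : 0 < n%:R ^+ 4 :> R by rewrite exprn_gt0.
apply: (@le_trans _ _ (2 * n%:R ^+ 4 * (expR 2 / n%:R ^+ 8))).
  by rewrite ler_wpM2l // mulr_ge0 // ltW.
have -> : 2 * n%:R ^+ 4 * (expR 2 / n%:R ^+ 8) = 2 * expR 2 / n%:R ^+ 4 :> R.
  by field; rewrite gt_eqF.
rewrite ler_pdivrMr // ler_pdivlMl ?mulr_gt0 //.
(* What remains is [4 * expR 1 ^+ 3 <= n ^+ 4], which follows from [expR 1 <= 4 <= n]. *)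
have -> : expR 2 = expR 1 ^+ 2 :> R by rewrite -expRM_natl mulr1.
have : n%:R ^+ 4 >= 4 ^+ 4 :> R by rewrite lerXn2r // nnegrE ltW.
have : expR 1 ^+ 3 <= 4 ^+ 3 :> R by rewrite lerXn2r // nnegrE ltW.
lra.
Qed.
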